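(* Let $(\alpha_k,\beta_k)_{k\ge 0}$ be a sequence satisfying $(\alpha_{k+1},\beta_{k+1})=f(\alpha_k,\beta_k)$ for all $k\ge 0$. If $(\alpha_{k_0},\beta_{k_0})\in R$ for some $k_0$, then $(\alpha_k,\beta_k)\in R$ for all $k\ge k_0$.
   Context: The map $f$ gives the Type I and Type II error probabilities after likelihood-ratio fusion of two independent binary messages with common error probabilities $(\alpha,\beta)$: $$f(\alpha,\beta)=\begin{cases}(1-(1-\alpha)^2,\ \beta^2), & \alpha\le\beta,\\ (\alpha^2,\ 1-(1-\beta)^2), & \alpha>\beta.\end{cases}$$ Regions: $\mathcal U=\{(\alpha,\beta): \alpha,\beta\ge 0,\ \alpha+\beta<1,\ \beta\ge\alpha\}$, $\mathcal L=\{(\alpha,\beta): \alpha,\beta\ge 0,\ \alpha+\beta<1,\ \beta<\alpha\}$, $R_{\mathcal U}=\{(\alpha,\beta)\in\mathcal U: \sqrt{1-\beta}+\sqrt{\alpha}\ge 1\}$, $R_{\mathcal L}=\{(\alpha,\beta)\in\mathcal L: \sqrt{1-\alpha}+\sqrt{\beta}\ge 1\}$, and $R=R_{\mathcal U}\cup R_{\mathcal L}$. *)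

(* Defs.v *)
From Stdlib Require Import Reals.
Open Scope R_scope.

(* A point is a pair (alpha, beta) = (Type I, Type II) error probabilities;
   [fusion] gives those of the likelihood-ratio fusion of two independent
   binary messages with common error probabilities p. *)
Definition fusion (p : R * R) : R * R :=
  let (a, b) := p in
  if Rle_dec a b
  then (1 - (1 - a) ^ 2, b ^ 2)
  else (a ^ 2, 1 - (1 - b) ^ 2).

Definition regU (p : R * R) : Prop :=
  let (a, b) := p in 0 <= a /\ 0 <= b /\ a + b < 1 /\ b >= a.

Definition regL (p : R * R) : Prop :=
  let (a, b) := p in 0 <= a /\ 0 <= b /\ a + b < 1 /\ b < a.

(* On [regU] and [regL] both coordinates lie in [0, 1], so the square roots
   below are taken of nonnegative numbers. *)
Definition R_U (p : R * R) : Prop :=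
  regU p /\ sqrt (1 - snd p) + sqrt (fst p) >= 1.

Definition R_L (p : R * R) : Prop :=
  regL p /\ sqrt (1 - fst p) + sqrt (snd p) >= 1.

Definition regR (p : R * R) : Prop := R_U p \/ R_L p.

(* Main.v *)
(** One fusion step either stays on the same side of the diagonal or crosses it.
    If it stays, the coordinate under the plain root increases and the
    coordinate under [sqrt (1 - _)] decreases, so the sum of roots increases.
    If it crosses, both new roots are exact, and the sum of roots becomes
    [1 + |beta - alpha|]. *)
Require Import Defs.
From Stdlib Require Import Reals Psatz.
Open Scope R_scope.

(** On the unit interval [y ^ 2 <= y], and [1 - (1 - x) ^ 2] exceeds [x] by [x * (1 - x) >= 0]. *)
Lemma sqrt_sum_le_step (x y : R) : 0 <= x <= 1 -> 0 <= y <= 1 ->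
  sqrt (1 - y) + sqrt x <= sqrt (1 - y ^ 2) + sqrt (1 - (1 - x) ^ 2).
Proof.
  intros Hx Hy.
  apply Rplus_le_compat; apply sqrt_le_1_alt; nra.
Qed.

Lemma sqrt_sum_crossing (x y : R) : x <= 1 -> 0 <= y ->
  sqrt (1 - (1 - (1 - x) ^ 2)) + sqrt (y ^ 2) = 1 - x + y.
Proof.
  intros Hx Hy.
  replace (1 - (1 - (1 - x) ^ 2)) with ((1 - x) ^ 2) by ring.
  rewrite !sqrt_pow2; lra.
Qed.

Lemma regR_fusion (p : R * R) : regR p -> regR (fusion p).
Proof.
  destruct p as [a b].
  unfold regR, R_U, R_L, regU, regL, fusion; cbn [fst snd].
  intros [[(Ha & Hb & Hab & Hba) Hs] | [(Ha & Hb & Hab & Hba) Hs]];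
    destruct (Rle_dec a b) as [Hle | Hle]; try lra; cbn [fst snd].
  - destruct (Rle_lt_dec (1 - (1 - a) ^ 2) (b ^ 2)) as [H | H].
    (* The new coordinates still sum to less than 1: this amounts to [b ^ 2 < (1 - a) ^ 2], which
       follows from [0 <= b < 1 - a]. *)
    + left; split; [repeat split; nra |].
      pose proof (sqrt_sum_le_step a b ltac:(split; lra) ltac:(split; lra)); lra.
    + right; split; [repeat split; nra |].
      rewrite sqrt_sum_crossing; lra.
  (* Mirror image of the previous case: both lemmas are used with [x := b] and [y := a]. *)
  - destruct (Rle_lt_dec (a ^ 2) (1 - (1 - b) ^ 2)) as [H | H].
    + left; split; [repeat split; nra |].
      rewrite sqrt_sum_crossing; lra.
    + right; split; [repeat split; nra |].
      pose proof (sqrt_sum_le_step b a ltac:(split; lra) ltac:(split; lra)); lra.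
Qed.

Theorem proposition1 (alpha beta : nat -> R)
  (hrec : forall k : nat, (alpha (S k), beta (S k)) = fusion (alpha k, beta k))
  (k0 : nat) (hk0 : regR (alpha k0, beta k0)) :
  forall k : nat, (k0 <= k)%nat -> regR (alpha k, beta k).
Proof.
  intros k Hk; induction Hk as [| k _ IH]; [exact hk0 |].
  rewrite hrec; exact (regR_fusion _ IH).
Qed.
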